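(* For every integer $n\ge1$, $$\hat{A}_n(t,p,q)=\sum_{k=0}^{\lfloor\frac{n}{2}\rfloor}\hat{\gamma}_k(p,q)\,t^k(1+t)^{n-2k},$$ where (with $n$ fixed) $$\hat{\gamma}_k(p,q)=\sum_{\sigma\in\hat{\Gamma}_{n,k}}p^{\mathrm{nest}(\sigma)}q^{\mathrm{cros}(\sigma)+k}=\sum_{\sigma\in\tilde{\Gamma}_{n,k}}p^{(2\text{-}31)\sigma}q^{(31\text{-}2)\sigma+k}.$$
   Context: The polynomials $\hat A_n(t,p,q)$ are defined by the formal power series identity $$\sum_{n\geq 0} \hat{A}_n(t,p,q)x^n =\cfrac{1}{1-b_0x-\cfrac{\lambda_1 x^2}{1-b_1x-\cfrac{\lambda_2 x^2}{1-\cdots}}},$$ where $b_n=(1+t)[n+1]_{p,q}$ ($n\ge0$), $\lambda_n=tq[n]_{p,q}^2$ ($n\ge1$), and $[n]_{p,q}=p^{n-1}+p^{n-2}q+\cdots+pq^{n-2}+q^{n-1}$. Let $\mathfrak S_n$ be the set of permutations of $[n]=\{1,\dots,n\}$. For $\sigma=\sigma_1\cdots\sigma_n\in\mathfrak S_n$ (with $\sigma(i)=\sigma_i$) define: - $\mathrm{cros}(\sigma)=|\{(i,j)\in[n]\times[n]: i<j\le\sigma_i<\sigma_j\text{ or }i>j>\sigma_i>\sigma_j\}|$; - $\mathrm{nest}(\sigma)=|\{(i,j)\in[n]\times[n]: i<j\le\sigma_j<\sigma_i\text{ or }i>j>\sigma_j>\sigma_i\}|$; - $\mathrm{drop}(\sigma)=|\{2\le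 i\le n:\sigma_i<i\}|$; - $\mathrm{cdfall}(\sigma)=|\{i\in[n]:\sigma^{-1}(i)>i>\sigma(i)\}|$; - $(2\text{-}31)\sigma=|\{(i,j):1\le i<j\le n-1,\ \sigma_{j+1}<\sigma_i<\sigma_j\}|$; - $(31\text{-}2)\sigma=|\{(i,j):2\le i<j\le n,\ \sigma_i<\sigma_j<\sigma_{i-1}\}|$; - $\mathrm{des}(\sigma)=|\{i\in[n-1]:\sigma_i>\sigma_{i+1}\}|$; - $\mathrm{dd}(\sigma)$, the number of non-initial double descents, i.e. the number of indices $2\le i\le n$ with $\sigma_{i-1}>\sigma_i>\sigma_{i+1}$, where $\sigma_{n+1}=+\infty$. Finally, $$\hat\Gamma_{n,k}=\{\sigma\in\mathfrak S_n:\mathrm{cdfall}(\sigma)=0,\ \mathrm{drop}(\sigma)=k\},\qquad \tilde\Gamma_{n,k}=\{\sigma\in\mathfrak S_n:\mathrm{dd}(\sigma)=0,\ \mathrm{des}(\sigma)=k\}.$$ *)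

(* Defs.v *)
From HB Require Import structures.
From mathcomp Require Import all_boot all_order all_algebra all_fingroup.
From mathcomp Require Import mpoly.

Set Implicit Arguments.
Unset Strict Implicit.
Unset Printing Implicit Defensive.

Import GRing.Theory.

Local Open Scope ring_scope.

Section FormalPowerSeries.

Variable R : comNzRingType.

(* A formal power series is represented by its sequence of coefficients. *)
Definition fps := nat -> R.

Implicit Types u v w : fps.

Definition fps_one : fps := fun n => (n == 0%N)%:R.

Definition fps_mul u v : fps := fun n => \sum_(i < n.+1) u i * v (n - i)%N.

Definition fps_exp u k : fps := iter k (fps_mul u) fps_one.

(* 1 / (1 - u) for u with zero constant term, as a geometric series: u ^ k    *)
(* then has no coefficient below x ^ k. See fps_geomP.                        *)
Definition fps_geom u : fps := fun n => \sum_(k < n.+1) fps_exp u k n.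

(* jconvergent b lam m h is the finite continued fraction                     *)
(*   1 / (1 - b_h x - lam_(h+1) x^2 /                                         *)
(*     (1 - b_(h+1) x - ... lam_(h+m) x^2 / (1 - b_(h+m) x))).                *)
Fixpoint jconvergent (b lam : nat -> R) (m h : nat) : fps :=
  fps_geom (fun k => match k with
    | 0 => 0
    | 1 => b h
    | k'.+2 => if m is m'.+1 then lam h.+1 * jconvergent b lam m' h.+1 k' else 0
    end).

(* The infinite continued fraction is the x-adic limit of its convergents:    *)
(* the coefficient of x ^ n is constant from the n-th convergent on, see      *)
(* jconvergent_stable.                                                        *)
Definition jfraction (b lam : nat -> R) : fps :=
  fun n => jconvergent b lam n 0 n.

Lemma fps_exp_lt u k n : u 0%N = 0 -> (n < k)%N -> fps_exp u k n = 0.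
Proof.
move=> u0; elim: k n => // k IHk n ltnk; rewrite /fps_exp iterS.
rewrite /fps_mul big1 // => -[[|i] lti] _ /=; first by rewrite u0 mul0r.
by rewrite -/(fps_exp u k) IHk ?mulr0 //; case: n ltnk lti => // n ltnk _;
  rewrite subSS (leq_ltn_trans (leq_subr _ _)).
Qed.

Lemma fps_geom_widen u n N : u 0%N = 0 -> (n < N)%N ->
  fps_geom u n = \sum_(k < N) fps_exp u k n.
Proof.
move=> u0 ltnN; rewrite /fps_geom (big_ord_widen _ (fun k => fps_exp u k n) ltnN).
rewrite big_mkcond; apply: eq_bigr => k _; case: ifP => // /negbT.
by rewrite -leqNgt => ltnk; rewrite fps_exp_lt.
Qed.

Lemma fps_geomP u : u 0%N = 0 ->
  fps_mul (fun n => fps_one n - u n) (fps_geom u) =1 fps_one.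
Proof.
move=> u0 n; rewrite /fps_mul.
under eq_bigr => i _ do
  rewrite mulrBl (@fps_geom_widen u (n - i) n.+1) ?ltnS ?leq_subr //.
rewrite sumrB big_ord_recl [X in _ + X - _]big1 => [|i _]; last by rewrite /fps_one /= mul0r.
rewrite /fps_one addr0 mul1r subn0.
under [X in _ - X]eq_bigr => i _ do rewrite mulr_sumr.
rewrite exchange_big /= -sumrB.
rewrite (eq_bigr (fun k : 'I_n.+1 => fps_exp u k n - fps_exp u k.+1 n)) //.
under eq_bigr => k _ do rewrite -opprB.
rewrite sumrN -(big_mkord xpredT (fun k => fps_exp u k.+1 n - fps_exp u k n)).
by rewrite telescope_sumr // opprB (@fps_exp_lt u n.+1) // subr0.
Qed.

Lemma fps_exp_eq u v k n : (forall i, (i <= n)%N -> u i = v i) ->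
  fps_exp u k n = fps_exp v k n.
Proof.
elim: k n => // k IHk n euv; rewrite /fps_exp !iterS /fps_mul.
apply: eq_bigr => i _; rewrite euv -1?ltnS // -!/(fps_exp _ k) IHk // => j lej.
by rewrite euv // (leq_trans lej) ?leq_subr.
Qed.

Lemma jconvergent_stable b lam m h n : (n <= m)%N ->
  jconvergent b lam m h n = jconvergent b lam n h n.
Proof.
have gen n' m1 m2 h' : (n' <= m1)%N -> (n' <= m2)%N ->
    jconvergent b lam m1 h' n' = jconvergent b lam m2 h' n'.
  elim/ltn_ind: n' m1 m2 h' => n' IHn m1 m2 h' le1 le2.
  case: m1 m2 le1 le2 => [|m1] [|m2] le1 le2; rewrite /= /fps_geom;
    apply: eq_bigr => k _; apply: fps_exp_eq => -[|[|i]] // lei.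
  - by have := leq_trans lei le1.
  - by have := leq_trans lei le2.
  - by congr (_ * _); apply: IHn; rewrite -ltnS ?(leq_trans _ le1)
      ?(leq_trans _ le2) ?ltnS // ltnW.
by move=> lenm; apply: gen.
Qed.

Definition pqint (p q : R) (n : nat) : R :=
  \sum_(i < n) p ^+ (n.-1 - i) * q ^+ i.

Definition Ahat (t p q : R) : nat -> R :=
  jfraction (fun n => (1 + t) * pqint p q n.+1)
            (fun n => t * q * pqint p q n ^+ 2).

End FormalPowerSeries.

(* Positions and letters of a permutation s : 'S_n are numbered from 0 to     *)
(* n - 1 instead of from 1 to n: both are shifted by one, so comparisons      *)
(* between positions, between letters, or between the two are unaffected.     *)
Section PermutationStatistics.

Local Open Scope nat_scope.

Variables (n : nat).
Implicit Types (s : 'S_n).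

Definition cros s : nat :=
  #|[set ij : 'I_n * 'I_n | let: (i, j) := ij in
      [&& i < j, j <= s i & s i < s j] || [&& i > j, j > s i & s i > s j]]|.

Definition nest s : nat :=
  #|[set ij : 'I_n * 'I_n | let: (i, j) := ij in
      [&& i < j, j <= s j & s j < s i] || [&& i > j, j > s j & s j > s i]]|.

Definition drop_stat s : nat := #|[set i : 'I_n | (0 < i) && (s i < i)]|.

Definition cdfall s : nat :=
  #|[set i : 'I_n | ((s^-1)%g i > i) && (i > s i)]|.

(* The letter of s in position i; positions past the end hold n, which is     *)
(* larger than all letters and serves as +oo.                                 *)
Definition letter s (i : nat) : nat :=
  if insub i is Some k then nat_of_ord (s k) else n.

Definition pat2_31 s : nat :=
  #|[set ij : 'I_n * 'I_n | let: (i, j) := ij in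
      [&& i < j, j.+1 < n, letter s j.+1 < s i & s i < s j]]|.

Definition pat31_2 s : nat :=
  #|[set ij : 'I_n * 'I_n | let: (i, j) := ij in
      [&& 0 < i, i < j, s i < s j & s j < letter s i.-1]]|.

Definition des s : nat :=
  #|[set i : 'I_n | (i.+1 < n) && (s i > letter s i.+1)]|.

Definition dd s : nat :=
  #|[set i : 'I_n |
      [&& 0 < i, letter s i.-1 > s i & s i > letter s i.+1]]|.

Definition Gamma_hat (k : nat) : {set 'S_n} :=
  [set s | (cdfall s == 0) && (drop_stat s == k)].

Definition Gamma_tilde (k : nat) : {set 'S_n} :=
  [set s | (dd s == 0) && (des s == k)].

End PermutationStatistics.

Definition gamma_hat (R : comNzRingType) (p q : R) (n k : nat) : R :=
  \sum_(s in Gamma_hat n k) p ^+ nest s * q ^+ (cros s + k).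

(* The three indeterminates of Z[t, p, q]. *)
Definition tX : {mpoly int[3]} := 'X_(@Ordinal 3 0 isT).
Definition pX : {mpoly int[3]} := 'X_(@Ordinal 3 1 isT).
Definition qX : {mpoly int[3]} := 'X_(@Ordinal 3 2 isT).

(* Main.v *)
Require Import Defs.
From mathcomp Require Import all_boot all_order all_algebra all_fingroup.
From mathcomp Require Import mpoly ring zify.

(* Expanding the continued fraction (Flajolet) turns Ahat_n into a sum over   *)
(* Motzkin paths of length n in which a fall from height h is weighted by     *)
(* t q [h]^2 and a level step at height h by (1 + t) [h+1]. A path with k     *)
(* falls has n - 2k level steps, so it remains to show that both permutation  *)
(* sums count these paths by their falls.                                     *)
(*                                                                            *)
(* Each permutation is read as a sequence of n labelled steps. For the cyclic *)
(* statistics (Foata-Zeilberger), step i records which open position receives *)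
(* the value i and which open value the position i takes; the label is the    *)
(* rank of the choice, which is a number of nestings. For the linear ones     *)
(* (Francon-Viennot), the letters are inserted in increasing order and the    *)
(* label of v is the number of blocks of smaller letters starting to its      *)
(* left, which is the number of patterns 31-2 with v as the 2. In both cases  *)
(* the labels determine the permutation, and there are exactly n! valid label *)
(* sequences, so no inverse map has to be built. The vanishing of cdfall (dd) *)
(* removes one of the two kinds of level steps.                               *)

Set Implicit Arguments.
Unset Strict Implicit.
Unset Printing Implicit Defensive.

Import GRing.Theory.
Local Open Scope ring_scope.

(** * Motzkin paths and continued fractions *)

(** Write [[h]] for [pqint p q h]. Everything is compared with [motz_pq p q y z n], the sum over
    Motzkin paths of length [n] in which a fall from height [h] weighs [y * q * [h]^2] and a level
    step at [h] weighs [z * [h+1]]. By [jfraction_motz] it equals the polynomial [Ahat] at [y = t],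
    [z = 1 + t]. By [sum_nest_cros] and [sum_pat31] it is also the generating function of the
    permutations with [cdfall = 0] and of those with [dd = 0], where [y] marks [drop_stat], resp.
    [des], and [z] marks the remaining level steps. Hence [y = t], [z = 1 + t] gives the expansion
    of [Ahat], while the coefficient of [y^k] at [z = 1] identifies the two permutation sums. The
    two generating functions rest on [sum_hists_inj]: the encodings are injective ([word_cyc_inj],
    [word_lin_inj]) and their targets have [n!] elements ([size_hists_cyc], [size_hists_lin]). *)

Section Motzkin.
Variable R : comNzSemiRingType.
Implicit Types u b d : nat -> R.

(** Weighted paths from height [h] down to 0. At height 0 the fall term stays at 0 because
    [0.-1 = 0], so the intended reading requires [d 0 = 0]. *)
Fixpoint motz u b d n h : R :=
  if n is n'.+1 then
    u h * motz u b d n' h.+1 + b h * motz u b d n' h + d h * motz u b d n' h.-1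
  else (h == 0%N)%:R.

Lemma eq_motz u u' b b' d d' n h : u =1 u' -> b =1 b' -> d =1 d' ->
  motz u b d n h = motz u' b' d' n h.
Proof. by move=> eu eb ed; elim: n h => //= n IH h; rewrite eu eb ed !IH. Qed.

(** A path from [h] to 0 falls from [i.+1] as often as it rises from [i], with one extra fall when
    [i < h]. Moving the weights [u] from rises to falls therefore only creates the factor for the
    extra falls. *)
Lemma motz_rescale u b d n h : d 0%N = 0 ->
  motz (fun=> 1) b (fun i => u i.-1 * d i) n h
    = (\prod_(i < h) u i) * motz u b d n h.
Proof.
move=> d0; elim: n h => [|n IH] h /=.
  by case: h => [|h]; rewrite ?big_ord0 ?mul1r ?mulr0.
rewrite !IH big_ord_recr /= !mulrDr; congr (_ + _ + _).
- by rewrite mul1r mulrA.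
- exact: mulrCA.
- case: h => [|h] /=; first by rewrite d0 !(mulr0, mul0r).
  rewrite big_ord_recr /=; set x := \prod_(_ < _) _.
  by rewrite !mulrA (mulrC x) -!mulrA (mulrCA x).
Qed.
End Motzkin.

Section Flajolet.
Variable R : comNzRingType.
Implicit Types u v w : fps R.

Lemma fps_mulE N u v n : (n < N)%N ->
  fps_mul u v n = ((\poly_(i < N) u i) * (\poly_(i < N) v i))`_n.
Proof.
move=> ltnN; rewrite coefM; apply: eq_bigr => i _; rewrite !coef_poly.
by rewrite (leq_trans (ltn_ord i)) // (leq_ltn_trans (leq_subr _ _) ltnN).
Qed.

(** The coefficient of [x^n] depends only on the truncations to degree at most [n], so associativity
    is inherited from polynomials. *)
Lemma fps_mulA u v w : fps_mul u (fps_mul v w) =1 fps_mul (fps_mul u v) w.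
Proof.
move=> n; pose T x : {poly R} := \poly_(i < n.+1) x i.
have mulT x y : T (fps_mul x y) = take_poly n.+1 (T x * T y).
  apply/polyP => i; rewrite coef_poly coef_take_poly.
  by case: ifP => // ltin; rewrite (fps_mulE _ _ ltin).
rewrite !(@fps_mulE n.+1) // -!/(T _) !mulT.
transitivity ((T u * (T v * T w))`_n).
  rewrite !coefM; apply: eq_bigr => i _.
  by rewrite coef_take_poly ltnS leq_subr.
rewrite mulrA !coefM; apply: eq_bigr => i _.
by rewrite coef_take_poly ltn_ord.
Qed.

Lemma eq_fps_mul u u' v v' : u =1 u' -> v =1 v' -> fps_mul u v =1 fps_mul u' v'.
Proof. by move=> eu ev n; apply: eq_bigr => i _; rewrite eu ev. Qed.

Lemma fps_mul1 u : fps_mul (fps_one R) u =1 u.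
Proof.
move=> n; rewrite /fps_mul big_ord_recl big1 => [|i _].
  by rewrite addr0 subn0 mul1r.
by rewrite /fps_one mul0r.
Qed.

Definition fps_shift u : fps R := fun n => if n is n'.+1 then u n' else 0.

Lemma fps_mul_shift u v : fps_mul u (fps_shift v) =1 fps_shift (fps_mul u v).
Proof.
case=> [|n]; rewrite /fps_mul /=; first by rewrite big_ord1 mulr0.
rewrite big_ord_recr /= subnn mulr0 addr0; apply: eq_bigr => i _.
by rewrite subSn // -ltnS.
Qed.

Lemma fps_mulZr u c v n : fps_mul u (fun i => c * v i) n = c * fps_mul u v n.
Proof. by rewrite mulr_sumr; apply: eq_bigr => i _; rewrite mulrCA. Qed.

Variables b lam : nat -> R.

(** The continued fraction read from level [h] on, called [J_h] below; [1 - jden h] is its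
    denominator. *)
Definition jtail h : fps R := fun n => jconvergent b lam n h n.

Definition jden h : fps R := fun k => match k with
  | 0 => 0 | 1 => b h | k'.+2 => lam h.+1 * jtail h.+1 k' end.

Lemma jtail_geom h : jtail h =1 fps_geom (jden h).
Proof.
move=> n; rewrite /jtail; case: n => [|n] /=; apply: eq_bigr => k _;
  apply: fps_exp_eq => -[|[|i]] // lein.
by rewrite jconvergent_stable // -ltnS ltnW.
Qed.

Lemma jtail_eq h : fps_mul (fun n => fps_one R n - jden h n) (jtail h) =1 fps_one R.
Proof. by move=> n; rewrite (eq_fps_mul (frefl _) (@jtail_geom h)) fps_geomP. Qed.

(* The generating function of the paths from height h down to 0 factors,      *)
(* by first passage, as lam_1 ... lam_h x^h J_0 ... J_h.                      *)
Fixpoint jpath h : fps R :=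
  if h is h'.+1 then
    fps_shift (fun n => lam h * fps_mul (jtail h) (jpath h') n)
  else jtail 0.

Lemma jpath_den h : fps_mul (fun n => fps_one R n - jden h n) (jpath h) =1
  if h is h'.+1 then fps_shift (fun n => lam h * jpath h' n) else fps_one R.
Proof.
case: h => [|h] /=; first exact: jtail_eq.
move=> n; rewrite fps_mul_shift; case: n => //= n.
rewrite fps_mulZr fps_mulA; congr (_ * _).
by rewrite (eq_fps_mul (@jtail_eq _) (frefl _)) fps_mul1.
Qed.

(** This is the coefficient of [x^(n+1)] in [jpath_den]: the term [lam_(h+1) x^2 J_(h+1)] of the
    denominator times [jpath h] is [x * jpath h.+1]. The result is the recursion of [motz]. *)
Lemma jpath_rec h n : lam 0%N = 0 ->
  jpath h n.+1 = jpath h.+1 n + b h * jpath h n + lam h * jpath h.-1 n.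
Proof.
move=> lam0; have := jpath_den h n.+1.
have -> : fps_mul (fun n => fps_one R n - jden h n) (jpath h) n.+1 =
    jpath h n.+1 - (jpath h.+1 n + b h * jpath h n).
  rewrite /fps_mul; under eq_bigr => i _ do rewrite mulrBl.
  rewrite sumrB -/(fps_mul _ _ _) fps_mul1; congr (_ - _).
  rewrite big_ord_recl /= mul0r add0r big_ord_recl /= subSS subn0 addrC.
  congr (_ + _); case: n => [|n] /=; first by rewrite big_ord0.
  rewrite /fps_mul mulr_sumr; apply: eq_bigr => i _.
  by rewrite /bump /= !add1n !subSS mulrA.
move/(canRL (subrK _)) => ->; rewrite addrC; congr (_ + _).
by case: h => [|h] //=; rewrite /fps_one lam0 mul0r.
Qed.

Lemma jfraction_motz n : lam 0%N = 0 ->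
  jfraction b lam n = motz (fun=> 1) b lam n 0.
Proof.
move=> lam0; suff gen h : jpath h n = motz (fun=> 1) b lam n h by exact: (gen 0).
elim: n h => [|n IH] h /=; last by rewrite jpath_rec // !IH mul1r.
by case: h => [|h] //=; rewrite jtail_geom /fps_geom big_ord1.
Qed.
End Flajolet.

(** * Labelled paths *)

(* In a step [((a, b), (r, s))] the height goes up by [1 - a - b]. For the    *)
(* cyclic encoding, [a] and [b] say that the value i, resp. the position i,   *)
(* is matched to something at most i, resp. less than i, and [r], [s] are the *)
(* ranks of the matches. For the linear one they say that the letter is not   *)
(* preceded by a larger one, resp. is followed by a smaller one; [s] is 0.    *)
Definition step : Type := bool * bool * (nat * nat).

Definition after (h : nat) (l : step) : nat := h.+1 - (l.1.1 + l.1.2).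

Section Histories.
Variable labs : nat -> seq step.

Fixpoint hists n h : seq (seq step) :=
  if n is n'.+1 then [seq l :: w | l <- labs h, w <- hists n' (after h l)]
  else if h == 0%N then [:: [::]] else [::].

Lemma hists_uniq n h : (forall h, uniq (labs h)) -> uniq (hists n h).
Proof.
move=> ulabs; elim: n h => [|n IH] h /=; first by case: ifP.
apply: allpairs_uniq_dep => // [[l w] [l' w'] _ _ /= [-> ew]].
by rewrite ew.
Qed.

Lemma hists_mem n (ht : nat -> nat) (lab : 'I_n -> step) :
    (forall i : 'I_n, lab i \in labs (ht i)) ->
    (forall i : 'I_n, after (ht i) (lab i) = ht i.+1) -> ht n = 0%N ->
  [seq lab i | i <- enum 'I_n] \in hists n (ht 0%N).
Proof.
elim: n ht lab => [|n IH] ht lab labP htP htn /=.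
  by rewrite (size0nil (size_enum_ord 0)) htn mem_head.
apply/allpairsPdep; exists (lab ord0), [seq lab i | i <- map (lift ord0) (enum 'I_n)].
split; [exact: labP ord0 | | by rewrite -map_cons -enum_ordSl].
rewrite (htP ord0) -map_comp; apply: (IH (fun i => ht i.+1) (lab \o lift ord0)) => // i.
- exact: (labP (lift ord0 i)).
- exact: (htP (lift ord0 i)).
Qed.

Lemma hists_balance n h w : (forall h l, l \in labs h -> l.1.1 + l.1.2 <= h.+1)%N ->
  w \in hists n h ->
  (\sum_(l <- w) l.1.1 + \sum_(l <- w) l.1.2 = n + h)%N.
Proof.
move=> labsP; elim: n h w => [|n IH] h w /=.
  by case: eqP => // -> /[!inE] /eqP ->; rewrite !big_nil.
case/allpairsPdep=> l [w' [/labsP hl /IH]]; rewrite /after => e ->.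
by rewrite !big_cons -addnACA {}e addnCA subnKC // addnS addSn.
Qed.

Section Weights.
Variables (R : comNzSemiRingType) (wt : nat -> step -> R).

Fixpoint hist_wt h (w : seq step) : R :=
  if w is l :: w' then wt h l * hist_wt (after h l) w' else 1.

Lemma sum_histsS n h :
  \sum_(w <- hists n.+1 h) hist_wt h w =
  \sum_(l <- labs h) wt h l *
    \sum_(w <- hists n (after h l)) hist_wt (after h l) w.
Proof.
by rewrite big_allpairs_dep; apply: eq_bigr => l _; rewrite mulr_sumr.
Qed.

Lemma hist_wt_prod n (ht : nat -> nat) (lab : 'I_n -> step) :
    (forall i : 'I_n, after (ht i) (lab i) = ht i.+1) ->
  hist_wt (ht 0%N) [seq lab i | i <- enum 'I_n] =
    \prod_(i < n) wt (ht i) (lab i).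
Proof.
elim: n ht lab => [|n IH] ht lab htP.
  by rewrite (size0nil (size_enum_ord 0)) big_ord0.
rewrite enum_ordSl big_ord_recl /= -map_comp (htP ord0); congr (_ * _).
by apply: (IH (fun i => ht i.+1) (lab \o lift ord0)) => i; exact: (htP (lift ord0 i)).
Qed.

End Weights.

Lemma sum_hists_inj (T : finType) (R : nmodType) n (F : T -> seq step)
    (G : seq step -> R) :
    (forall h, uniq (labs h)) -> (forall s, F s \in hists n 0) -> injective F ->
    size (hists n 0) = #|T| ->
  \sum_s G (F s) = \sum_(w <- hists n 0) G w.
Proof.
move=> ulabs memF injF sz; rewrite -big_enum -(big_map F predT G).
have ulF : uniq (map F (enum T)) by rewrite map_inj_uniq ?enum_uniq.
have subF : {subset map F (enum T) <= hists n 0} by move=> _ /mapP[s _ ->].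
apply: perm_big; apply: uniq_perm => //; first exact: hists_uniq.
by case: (uniq_min_size ulF subF) => //; rewrite size_map -cardE sz.
Qed.

Lemma size_hists n h :
  size (hists n h) = \sum_(w <- hists n h) hist_wt (fun _ _ => 1%N) h w.
Proof.
rewrite -sum1_size; apply: eq_bigr => w _.
by elim: w h => //= l w IH h; rewrite -IH mulr1.
Qed.

End Histories.

(** * The label sets of the two encodings and the number of labelled paths *)

Definition labs_cyc h : seq step :=
  (((false, false), (0, 0)) ::
   [seq ((true, false), (r, 0)) | r <- iota 0 h.+1] ++
   [seq ((false, true), (0, s)) | s <- iota 0 h] ++
   [seq ((true, true), (r, s)) | r <- iota 0 h, s <- iota 0 h])%N.

Definition labs_lin h : seq step :=
  ([seq ((false, false), (r, 0)) | r <- iota 0 h.+1] ++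
   [seq ((true, false), (r, 0)) | r <- iota 0 h.+1] ++
   [seq ((false, true), (r, 0)) | r <- iota 0 h] ++
   [seq ((true, true), (r, 0)) | r <- iota 0 h])%N.

(** The value [i] can go to one of [h] open positions, or to position [i] itself if that does not
    take a smaller value; this is the bound [r + b <= h]. *)
Lemma mem_labs_cyc h a b r s : ((a, b, (r, s)) \in labs_cyc h) =
  ((if a then r + b <= h else r == 0) && (if b then s < h else s == 0))%N.
Proof.
rewrite inE !mem_cat; apply/idP/idP.
  case/or4P=> [/eqP|/mapP[i]|/mapP[i]|/allpairsP[[i j] [/=]]]; rewrite ?mem_iota.
  - by case=> -> -> -> ->.
  - by move=> hi [-> -> -> ->]; lia.
  - by move=> hi [-> -> -> ->]; lia.
  - by move=> hi hj [-> -> -> ->]; lia.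
case: a b => [] [] /andP[hr hs]; apply/or4P.
- constructor 4; apply/allpairsP; exists (r, s); rewrite !mem_iota; split=> //=; lia.
- constructor 2; rewrite (eqP hs); apply/mapP; exists r => //; rewrite mem_iota; lia.
- constructor 3; rewrite (eqP hr); apply/mapP; exists s => //; rewrite mem_iota; lia.
- by constructor 1; rewrite (eqP hr) (eqP hs).
Qed.

(** If a smaller letter follows, it starts a block on the right, which leaves at most [h - 1] blocks
    on the left. *)
Lemma mem_labs_lin h a b r s : ((a, b, (r, s)) \in labs_lin h) =
  ((r + b <= h) && (s == 0))%N.
Proof.
rewrite !mem_cat; apply/idP/idP.
  by case/or4P=> /mapP[i]; rewrite mem_iota => hi [_ -> -> ->]; lia.
move=> /andP[hr /eqP ->]; apply/or4P.
case: a b hr => [] [] hr; [constructor 4|constructor 2|constructor 3|constructor 1];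
  apply/mapP; exists r => //; rewrite mem_iota; lia.
Qed.

Lemma uniq_cat_key (T : eqType) (k : T) (S : eqType) (f : S -> T) (s1 s2 : seq S) :
    all (fun x => f x == k) s1 -> all (fun x => f x != k) s2 ->
  uniq s1 -> uniq s2 -> uniq (s1 ++ s2).
Proof.
move=> /allP k1 /allP k2 u1 u2; rewrite cat_uniq u1 u2 andbT /=.
by apply/hasPn => x /k2; apply: contra => /k1.
Qed.

Lemma labs_cyc_uniq h : uniq (labs_cyc h).
Proof.
rewrite /labs_cyc -cat1s.
apply: (uniq_cat_key (k := (false, false)) (f := fst)) => //.
  by rewrite !all_cat !all_map; apply/and3P; split; do [exact/allP | exact/all_allpairsP].
apply: (uniq_cat_key (k := (true, false)) (f := fst)).
- by rewrite all_map; apply/allP.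
- by rewrite !all_cat !all_map; apply/andP; split; do [exact/allP | exact/all_allpairsP].
- by rewrite map_inj_uniq ?iota_uniq // => i j [].
apply: (uniq_cat_key (k := (false, true)) (f := fst)).
- by rewrite all_map; apply/allP.
- exact/all_allpairsP.
- by rewrite map_inj_uniq ?iota_uniq // => i j [].
by rewrite allpairs_uniq ?iota_uniq // => -[i j] [i' j'] _ _ [-> ->].
Qed.

Lemma labs_lin_uniq h : uniq (labs_lin h).
Proof.
have uP a b k : uniq [seq ((a, b), (r, 0))%N : step | r <- iota 0 k].
  by rewrite map_inj_uniq ?iota_uniq // => i j [].
apply: (uniq_cat_key (k := (false, false)) (f := fst)); rewrite ?uP //.
- by rewrite all_map; apply/allP.
- by rewrite !all_cat !all_map; apply/and3P; split; apply/allP.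
apply: (uniq_cat_key (k := (true, false)) (f := fst)); rewrite ?uP //.
- by rewrite all_map; apply/allP.
- by rewrite !all_cat !all_map; apply/andP; split; apply/allP.
apply: (uniq_cat_key (k := (false, true)) (f := fst)); rewrite ?uP //;
  by rewrite all_map; apply/allP.
Qed.

Section HistorySums.
Variable R : comNzSemiRingType.

Lemma sum_labs_cyc (F : step -> R) h :
  \sum_(l <- labs_cyc h) F l =
    F ((false, false), (0, 0))%N
    + (\sum_(r < h.+1) F ((true, false), (val r, 0%N))
       + \sum_(s < h) F ((false, true), (0%N, val s)))
    + \sum_(r < h) \sum_(s < h) F ((true, true), (val r, val s)).
Proof.
rewrite big_cons !big_cat !big_map big_allpairs_dep -!addrA.
have iotaE k : iota 0 k = index_iota 0 k by rewrite /index_iota subn0.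
rewrite !iotaE !big_mkord; do 3!congr (_ + _).
by apply: eq_bigr => r _; rewrite big_mkord.
Qed.

Lemma sum_labs_lin (F : step -> R) h :
  \sum_(l <- labs_lin h) F l =
    \sum_(r < h.+1) F ((false, false), (val r, 0%N))
    + (\sum_(r < h.+1) F ((true, false), (val r, 0%N))
       + \sum_(r < h) F ((false, true), (val r, 0%N)))
    + \sum_(r < h) F ((true, true), (val r, 0%N)).
Proof.
rewrite !big_cat -!addrA.
have iotaE k : iota 0 k = index_iota 0 k by rewrite /index_iota subn0.
by rewrite !big_map !iotaE !big_mkord.
Qed.

Lemma sum_hists_cyc (wt : nat -> step -> R) n h :
  \sum_(w <- hists labs_cyc n h) hist_wt wt h w =
  motz (fun h => wt h ((false, false), (0, 0))%N)
       (fun h => \sum_(r < h.+1) wt h ((true, false), (val r, 0%N))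
                 + \sum_(s < h) wt h ((false, true), (0%N, val s)))
       (fun h => \sum_(r < h) \sum_(s < h) wt h ((true, true), (val r, val s)))
       n h.
Proof.
elim: n h => [|n IH] h.
  by case: h => [|h]; rewrite /= ?big_nil // big_seq1.
rewrite sum_histsS sum_labs_cyc /= -!IH /after /= addn0 add0n !subn0 !subSS !subn0 subn1.
rewrite mulrDl !mulr_suml; congr (_ + _); apply: eq_bigr => r _.
by rewrite mulr_suml.
Qed.

Lemma sum_hists_lin (wt : nat -> step -> R) n h :
  \sum_(w <- hists labs_lin n h) hist_wt wt h w =
  motz (fun h => \sum_(r < h.+1) wt h ((false, false), (val r, 0%N)))
       (fun h => \sum_(r < h.+1) wt h ((true, false), (val r, 0%N))
                 + \sum_(r < h) wt h ((false, true), (val r, 0%N)))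
       (fun h => \sum_(r < h) wt h ((true, true), (val r, 0%N)))
       n h.
Proof.
elim: n h => [|n IH] h.
  by case: h => [|h]; rewrite /= ?big_nil // big_seq1.
rewrite sum_histsS sum_labs_lin /= -!IH /after /= addn0 add0n !subn0 !subSS !subn0 subn1.
by rewrite mulrDl !mulr_suml.
Qed.

End HistorySums.

(** With [h] open positions, [h] open values and [n] steps left, the open positions choose distinct
    new values in [n ^_ h] ways, and the [n] values then left go to the new positions in [n!] ways.
    General [h] is needed for the induction. *)
Lemma size_hists_cyc n h : size (hists labs_cyc n h) = (n`! * n ^_ h)%N.
Proof.
rewrite size_hists sum_hists_cyc.
rewrite (@eq_motz _ _ (fun=> 1) _ (fun h => h.+1 + h)%N _ (fun h => h * h)%N) //.
- elim: n h => [|n IH] h /=.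
    by case: h => [|h]; rewrite ?ffact0n mul1n.
  rewrite !IH {IH} mul1r factS.
  suff: (n ^_ h.+1 + (h.+1 + h) * n ^_ h + h * h * n ^_ h.-1 = n.+1 * n.+1 ^_ h)%N.
    by move=> e; rewrite -mulnA mulnCA -e; ring.
  case: h => [|h]; first by rewrite !ffactn0 ffactn1; lia.
  rewrite ffactSS !ffactnSr; case: (ltnP n h) => [ltnh|/subnKC <-].
    by rewrite (ffact_small ltnh) !muln0.
  move: (n - h)%N => d; have -> : (h + d - h.+1 = d.-1)%N by lia.
  by rewrite addKn; case: d => [|d]; rewrite ?muln0 ?addn0 /=; ring.
- by move=> i; rewrite !sum_nat_const !card_ord !muln1.
- by move=> i; rewrite !sum_nat_const !card_ord !muln1.
Qed.

Lemma size_hists_lin n : size (hists labs_lin n 0) = n`!.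
Proof.
rewrite size_hists sum_hists_lin.
transitivity (size (hists labs_cyc n 0)); last by rewrite size_hists_cyc muln1.
rewrite size_hists sum_hists_cyc.
(* The factor [h * h] of a cyclic fall is split as [i.-1.+1 * i] so that [motz_rescale] can move one
   half to the rises. *)
rewrite [RHS](@eq_motz _ _ (fun=> 1) _ (fun h => h.+1 + h)%N _
  (fun i => i.-1.+1 * i)%N) //; first last.
- by case=> [|i]; rewrite !sum_nat_const !card_ord !muln1.
- by move=> i; rewrite !sum_nat_const !card_ord !muln1.
rewrite (@motz_rescale _ succn _ id) // big_ord0 mul1r.
by apply: eq_motz => i; rewrite !sum_nat_const !card_ord !muln1.
Qed.

(** * Weights of labelled steps and the common path sum *)

Section StepWeights.
Variables (R : comNzRingType) (p q y z : R).

(* [y] marks the falls and [z] the level steps; steps of type [(false, true)] *)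
(* are excluded.                                                              *)
Definition step_wt (l : step) : R :=
  if l.1.2 then (if l.1.1 then q * y else 0) else if l.1.1 then z else 1.

(** A rank counts nestings; the other available choices, [h - b - r] for the value and [h - 1 - s]
    for the position, are the crossings. *)
Definition wt_cyc h (l : step) : R :=
  step_wt l * (if l.1.1 then p ^+ l.2.1 * q ^+ (h - l.1.2 - l.2.1) else 1)
            * (if l.1.2 then p ^+ l.2.2 * q ^+ (h.-1 - l.2.2) else 1).

(** Of the [h] blocks, [r] lie to the left and at most one directly follows the letter; those
    further right give the exponent of [p]. *)
Definition wt_lin h (l : step) : R :=
  step_wt l * (p ^+ (h - l.1.2 - l.2.1) * q ^+ l.2.1).

Definition motz_pq n : R :=
  motz (fun=> 1) (fun h => z * pqint p q h.+1) (fun h => y * q * pqint p q h ^+ 2) n 0.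

Lemma pqint_rev n : \sum_(r < n) p ^+ r * q ^+ (n.-1 - r) = pqint p q n.
Proof.
rewrite /pqint (reindex_inj rev_ord_inj); apply: eq_bigr => r _ /=.
by congr (_ ^+ _ * _ ^+ _); have := ltn_ord r; lia.
Qed.

Lemma sum_wt_cyc n :
  \sum_(w <- hists labs_cyc n 0) hist_wt wt_cyc 0 w = motz_pq n.
Proof.
rewrite sum_hists_cyc; apply: eq_motz => h; rewrite /wt_cyc /step_wt /=.
- by rewrite !mulr1.
- rewrite [X in _ + X]big1 => [|s _]; last by rewrite !mul0r.
  rewrite addr0 -pqint_rev mulr_sumr; apply: eq_bigr => r _.
  by rewrite mulr1 subn0.
- rewrite expr2 -pqint_rev mulr_suml mulr_sumr; apply: eq_bigr => r _.
  rewrite !mulr_sumr; apply: eq_bigr => s _.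
  by rewrite subn1 (mulrC y) !mulrA.
Qed.

Lemma sum_wt_lin n :
  \sum_(w <- hists labs_lin n 0) hist_wt wt_lin 0 w = motz_pq n.
Proof.
rewrite sum_hists_lin /motz_pq; pose u h := pqint p q h.+1.
pose d h := y * q * pqint p q h.
rewrite [RHS](@eq_motz _ _ (fun=> 1) _ (fun h => z * pqint p q h.+1) _
  (fun h => u h.-1 * d h)) //.
  rewrite motz_rescale ?big_ord0 ?mul1r; last by rewrite /d /pqint big_ord0 mulr0.
  apply: eq_motz => h; rewrite /wt_lin /step_wt /=.
  - by apply: eq_bigr => r _; rewrite mul1r subn0.
  - rewrite [X in _ + X]big1 => [|s _]; last by rewrite !mul0r.
    by rewrite addr0 mulr_sumr; apply: eq_bigr => r _; rewrite subn0.
  - rewrite /d mulr_sumr; apply: eq_bigr => r _.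
    by rewrite subn1 (mulrC y).
case=> [|h]; rewrite /d /u expr2; first by rewrite /pqint big_ord0 !mulr0.
by rewrite mulrCA.
Qed.

(** Without steps [(false, true)] the falls are the steps with second bit set, and the level steps
    are the difference of the two counts, which add up to [n]. *)
Lemma prod_step_wt n (lab : 'I_n -> step) :
    (\sum_i (lab i).1.1 + \sum_i (lab i).1.2 = n)%N ->
  \prod_i step_wt (lab i) =
    if (\sum_i (~~ (lab i).1.1 && (lab i).1.2) == 0)%N
    then (q * y) ^+ (\sum_i (lab i).1.2)%N * z ^+ (n - 2 * \sum_i (lab i).1.2)
    else 0.
Proof.
move=> e; have [|] := eqVneq.
  move/eqP; rewrite sum_nat_eq0 => /forallP /= h0.
  rewrite [in z ^+ _](_ : n - _ = \sum_i ((lab i).1.1 - (lab i).1.2))%N.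
    rewrite -!prodrXr -big_split; apply: eq_bigr => i _.
    rewrite /step_wt; move: (h0 i).
    by case: (lab i) => -[[] []] /= _; rewrite // ?mulr1 // mul1r.
  rewrite sumnB => [|i _]; last by move: (h0 i); case: (lab i) => -[[] []].
  by rewrite -{1}e mul2n -addnn subnDr.
rewrite sum_nat_eq0 negb_forall => /existsP[i hi].
rewrite (bigD1 i) //= /step_wt; move: hi.
by case: (lab i) => -[[] []] //= _ _; rewrite mul0r.
Qed.

End StepWeights.

Section RankSums.
Local Open Scope nat_scope.

Lemma sum_eqb n (x : 'I_n) (P : pred 'I_n) : \sum_j ((j == x) && P j) = P x.
Proof.
by rewrite (bigD1 x) //= eqxx big1 ?addn0 // => j /negPf ->.
Qed.

Lemma sum_perm n (s : 'S_n) (F : 'I_n -> nat) : \sum_i F (s i) = \sum_i F i.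
Proof. by rewrite [RHS](reindex_inj (@perm_inj _ s)). Qed.

Lemma card_set_sum (T : finType) (P : pred T) : #|[set x | P x]| = \sum_x P x.
Proof.
by rewrite -sum1_card big_mkcond; apply: eq_bigr => x _; rewrite inE; case: (P x).
Qed.

Lemma card_pairs_sum (T : finType) (P : T -> T -> bool) :
  #|[set ij : T * T | let: (i, j) := ij in P i j]| = \sum_i \sum_j P i j.
Proof. by rewrite card_set_sum pair_bigA; apply: eq_bigr => -[i j]. Qed.

Lemma rank_inj n (O : pred 'I_n) (x y : 'I_n) : O x -> O y ->
  \sum_l (O l && (l < x)) = \sum_l (O l && (l < y)) -> x = y.
Proof.
have lt_rank a b : O a -> a < b ->
    \sum_l (O l && (l < a)) < \sum_l (O l && (l < b)).
  move=> Oa ltab; have e1 : 1 = \sum_j ((j == a) && O j) by rewrite sum_eqb Oa.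
  rewrite -addn1 [X in _ + X]e1 -big_split; apply: leq_sum => l _ /=.
  have [->|ne] := eqVneq; first by rewrite Oa ltnn ltab.
  by case: (O l) => //=; lia.
move=> Ox Oy e; apply/val_inj; case: (ltngtP x y) => // lt.
  by have := lt_rank _ _ Ox lt; rewrite e ltnn.
by have := lt_rank _ _ Oy lt; rewrite e ltnn.
Qed.

End RankSums.

(** * Cyclic statistics *)

Section CyclicHistories.
Local Open Scope nat_scope.
Variable n : nat.
Implicit Types (s t : 'S_n) (i j l u : 'I_n).

(** View [s] as arcs joining each [j] to [s j]. The [up] counts concern the arc ending at the value
    [i], the [low] counts the arc leaving the position [i]. *)
Definition up_nest s i : nat :=
  \sum_(l < n) [&& l < (s^-1)%g i, (s^-1)%g i <= i & i < s l].
Definition up_cros s i : nat :=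
  \sum_(l < n) [&& (s^-1)%g i < l, l <= i & i < s l].
Definition low_nest s i : nat :=
  \sum_(u < n) [&& u < s i, s i < i & i < (s^-1)%g u].
Definition low_cros s i : nat :=
  \sum_(u < n) [&& s i < u, u < i & i < (s^-1)%g u].

Definition lab_cyc s i : step :=
  (((s^-1)%g i <= i, s i < i), (up_nest s i, low_nest s i)).

Definition ht_cyc s (k : nat) : nat := \sum_(j < n) ((j < k) && (k <= s j)).

Lemma perm_eqV s i j : (s j == i) = (j == (s^-1)%g i).
Proof. by rewrite (canF_eq (permK s)). Qed.

Lemma ht_cycS s i :
  ht_cyc s i.+1 + ((s^-1)%g i <= i) + (s i < i) = ht_cyc s i + 1.
Proof.
(* Each bit becomes a sum over positions supported at one point, so that both sides can be compared
   position by position. *)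
rewrite -(sum_eqb ((s^-1)%g i) (fun j => j <= i)) -(sum_eqb i (fun j => s j < j)).
rewrite -[1](sum_eqb i predT) -!big_split.
apply: eq_bigr => j _ /=; rewrite -perm_eqV -!val_eqE /=.
lia.
Qed.

(** There are as many open values as open positions; the increments for [s] and its inverse could
    only differ at a fixed point, which they share. *)
Lemma ht_cycV s k : k <= n -> ht_cyc s^-1 k = ht_cyc s k.
Proof.
elim: k => [|k IH] ltkn; first by rewrite /ht_cyc !big1.
have := ht_cycS s (Ordinal ltkn); have := ht_cycS s^-1 (Ordinal ltkn).
rewrite invgK /= IH ?(ltnW ltkn) //.
have := perm_eqV s (Ordinal ltkn) (Ordinal ltkn); rewrite -!val_eqE /=.
lia.
Qed.

Lemma up_nest_cros s i : (s^-1)%g i <= i ->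
  up_nest s i + up_cros s i = ht_cyc s i.+1.
Proof.
move=> ai; rewrite -big_split; apply: eq_bigr => l _ /=.
have := perm_eqV s i l; rewrite -!val_eqE /=.
lia.
Qed.

Lemma low_nest_cros s i : s i < i ->
  low_nest s i + low_cros s i + 1 = ht_cyc s i.
Proof.
move=> bi; rewrite -(ht_cycV s (ltnW (ltn_ord i))).
rewrite -[1](sum_eqb (s i) predT) -!big_split; apply: eq_bigr => u _ /=.
have := perm_eqV s u i; rewrite -!val_eqE /=.
have := ltn_ord (s i).
lia.
Qed.

Lemma after_lab_cyc s i : after (ht_cyc s i) (lab_cyc s i) = ht_cyc s i.+1.
Proof. by have := ht_cycS s i; rewrite /after addn1 -addnA => <-; rewrite addnK. Qed.

Lemma lab_cyc_mem s i : lab_cyc s i \in labs_cyc (ht_cyc s i).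
Proof.
rewrite mem_labs_cyc; have e := ht_cycS s i.
apply/andP; split; case: ifPn => h.
- have := up_nest_cros h; move: e; rewrite h.
  move: (ht_cyc s i.+1) (ht_cyc s i) (up_nest s i) (up_cros s i) => a b c d.
  by move: (nat_of_bool (s i < i)) => f; lia.
- by rewrite /up_nest sum_nat_eq0; apply/forallP => l; rewrite (negPf h) andbF.
- have := low_nest_cros h; move: e.
  by move: (ht_cyc s i) (low_nest s i) (low_cros s i); lia.
- by rewrite /low_nest sum_nat_eq0; apply/forallP => l; rewrite (negPf h) andbF.
Qed.

Definition word_cyc s : seq step := [seq lab_cyc s i | i <- enum 'I_n].

Lemma word_cyc_mem s : word_cyc s \in hists labs_cyc n 0.
Proof.
have -> : 0 = ht_cyc s 0 by rewrite /ht_cyc big1.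
apply: hists_mem; [exact: lab_cyc_mem | exact: after_lab_cyc |].
by rewrite /ht_cyc big1 // => j _; rewrite [n <= _]leqNgt (ltn_ord (s j)) andbF.
Qed.

Definition agree s t k := forall j, j < k -> s j < k -> t j = s j.

(** Agreement below [k] makes the open positions and the open values of [s] and [t] coincide, and a
    rank among them determines the element ([rank_inj]). *)
Lemma agreeS s t (k : 'I_n) : lab_cyc s k = lab_cyc t k ->
  agree s t k -> agree t s k -> agree s t k.+1.
Proof.
move=> [ea eb er el] Ast Ats j; rewrite !ltnS => ltjk.
have st_lt l : l < k -> (k <= s l) = (k <= t l).
  move=> ltlk; rewrite !(leqNgt k); congr (~~ _).
  by apply/idP/idP => h; [rewrite (Ast l) | rewrite (Ats l)].
have [ek _|nek lesk] := eqVneq (s j) k.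
  (* [j] and [t^-1 k] have the same rank among the open positions. *)
  have ej : j = (s^-1)%g k by rewrite -ek permK.
  have lejt : (t^-1)%g k <= k by rewrite -ea -ej.
  rewrite ek; suff -> : j = (t^-1)%g k by rewrite permKV.
  apply: (rank_inj (O := [pred l : 'I_n | (l <= k) && (k <= s l)])) => /=.
  - by rewrite ltjk ek leqnn.
  - rewrite lejt; move: lejt; rewrite leq_eqVlt => /orP[/eqP/val_inj ek'|ltk'].
      by rewrite ek' leqNgt eb -leqNgt -{2}ek' permKV leqnn.
    by rewrite st_lt // permKV leqnn.
  - transitivity (up_nest s k); last rewrite er; apply: eq_bigr => l _ /=.
      have := perm_eqV s k l; rewrite -!val_eqE -ej /=; lia.
    have := perm_eqV t k l; rewrite -!val_eqE /=.
    have := st_lt l; lia.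
(* [s j] and [t k] have the same rank among the open values. *)
have ltsk : s j < k by rewrite ltn_neqAle lesk andbT.
have [ltjk'|lekj] := ltnP j k; first exact: Ast.
have ej : j = k by apply/val_inj/eqP; rewrite eqn_leq ltjk.
rewrite {}ej {nek lesk ltjk lekj j} in ltsk *.
have ltt : t k < k by rewrite -eb.
have st_ltV u : u < k -> (k <= (s^-1)%g u) = (k <= (t^-1)%g u).
  move=> ltuk; rewrite !(leqNgt k); congr (~~ _); apply/idP/idP => h.
    by have := Ast _ h; rewrite permKV => /(_ ltuk) /(canRL (permK t)) <-.
  by have := Ats _ h; rewrite permKV => /(_ ltuk) /(canRL (permK s)) <-.
apply/esym/(rank_inj (O := [pred u : 'I_n | (u < k) && (k <= (s^-1)%g u)])) => /=.
- by rewrite ltsk permK leqnn.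
- by rewrite ltt st_ltV // permK leqnn.
- transitivity (low_nest s k); last rewrite el; apply: eq_bigr => u _ /=.
    have := perm_eqV s u k; rewrite -!val_eqE /=; lia.
  have := perm_eqV t u k; rewrite -!val_eqE /=.
  have := st_ltV u; lia.
Qed.

Lemma word_cyc_inj : injective word_cyc.
Proof.
move=> s t /eq_in_map e.
have {}e k : lab_cyc s k = lab_cyc t k by apply: e; rewrite mem_enum.
suff A k : k <= n -> agree s t k /\ agree t s k.
  by apply/permP => j; have [_ ->] := A n (leqnn n).
elim: k => [|k IH] ltkn; first by split.
have [Ast Ats] := IH (ltnW ltkn).
by split; [apply: (@agreeS s t (Ordinal ltkn)) | apply: (@agreeS t s (Ordinal ltkn))].
Qed.

(** Each nesting is charged to the larger endpoint of its inner arc. In [cros_sum] a crossing is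
    likewise charged to the larger endpoint of the arc that closes first. *)
Lemma nest_sum s : nest s = \sum_(i < n) (up_nest s i + low_nest s i).
Proof.
rewrite /nest card_pairs_sum big_split /=; pose U i j := [&& i < j, j <= s j & s j < s i].
pose L i j := [&& j < i, s j < j & s i < s j].
transitivity (\sum_(i < n) \sum_(j < n) U i j + \sum_(i < n) \sum_(j < n) L i j).
  rewrite -big_split; apply: eq_bigr => i _; rewrite -big_split; apply: eq_bigr => j _.
  rewrite /U /L /=; lia.
rewrite exchange_big /=; congr (_ + _).
  rewrite -(sum_perm (s^-1)%g); apply: eq_bigr => c _; apply: eq_bigr => i _.
  by rewrite /U permKV.
rewrite exchange_big; apply: eq_bigr => j _.
rewrite -(sum_perm (s^-1)%g); apply: eq_bigr => u _; rewrite /L permKV; lia.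
Qed.

Lemma cros_sum s : cros s = \sum_(i < n) (up_cros s i + low_cros s i).
Proof.
rewrite /cros card_pairs_sum big_split /=; pose U i j := [&& i < j, j <= s i & s i < s j].
pose L i j := [&& j < i, s i < j & s j < s i].
transitivity (\sum_(i < n) \sum_(j < n) U i j + \sum_(i < n) \sum_(j < n) L i j).
  rewrite -big_split; apply: eq_bigr => i _; rewrite -big_split; apply: eq_bigr => j _.
  rewrite /U /L /=; lia.
congr (_ + _).
  rewrite -(sum_perm (s^-1)%g); apply: eq_bigr => c _; apply: eq_bigr => i _.
  by rewrite /U permKV.
rewrite exchange_big; apply: eq_bigr => j _.
rewrite -(sum_perm (s^-1)%g); apply: eq_bigr => u _; rewrite /L permKV; lia.
Qed.

Lemma drop_sum s : drop_stat s = \sum_(i < n) (s i < i).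
Proof.
rewrite /drop_stat card_set_sum; apply: eq_bigr => i _; congr (nat_of_bool _); lia.
Qed.

Lemma cdfall_sum s : cdfall s = \sum_(i < n) (~~ ((s^-1)%g i <= i) && (s i < i)).
Proof. by rewrite /cdfall card_set_sum; apply: eq_bigr => i _; rewrite -ltnNge. Qed.

Lemma weak_exc_drop s :
  \sum_(i < n) ((s^-1)%g i <= i) + \sum_(i < n) (s i < i) = n.
Proof.
rewrite -(sum_perm s) -big_split -[RHS]card_ord -sum1_card; apply: eq_bigr => i _.
by rewrite permK /=; lia.
Qed.

Lemma drop_le s : cdfall s = 0 -> 2 * drop_stat s <= n.
Proof.
rewrite cdfall_sum drop_sum -[n in _ <= n](weak_exc_drop s) mul2n -addnn => /eqP.
rewrite sum_nat_eq0 => /forallP h; rewrite leq_add2r; apply: leq_sum => i _.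
by move: (h i); case: ((s^-1)%g i <= i); case: (s i < i).
Qed.

Local Open Scope ring_scope.

Lemma word_cyc_wt (R : comNzRingType) (p q y z : R) s :
  hist_wt (wt_cyc p q y z) 0 (word_cyc s) =
  if cdfall s == 0%N
  then p ^+ nest s * q ^+ (cros s + drop_stat s) * y ^+ drop_stat s
       * z ^+ (n - 2 * drop_stat s)
  else 0.
Proof.
have {1}-> : 0%N = ht_cyc s 0 by rewrite /ht_cyc big1.
rewrite (hist_wt_prod _ (@after_lab_cyc s)).
rewrite (eq_bigr (fun i => step_wt q y z (lab_cyc s i) *
   (p ^+ (up_nest s i + low_nest s i) * q ^+ (up_cros s i + low_cros s i)))).
  rewrite big_split /= prod_step_wt ?weak_exc_drop //= -cdfall_sum -drop_sum.
  case: ifP => _; last by rewrite mul0r.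
  rewrite big_split /= !prodrXr -nest_sum -cros_sum exprD exprMn; ring.
move=> i _; rewrite /wt_cyc /= -mulrA; congr (_ * _).
have e := ht_cycS s i.
have -> : (if ((s^-1)%g i <= i)%N
             then p ^+ up_nest s i * q ^+ (ht_cyc s i - (s i < i) - up_nest s i)
             else 1)
   = p ^+ up_nest s i * q ^+ up_cros s i.
  case: ifPn => h.
    congr (_ * _ ^+ _); have := up_nest_cros h; move: e; rewrite h.
    move: (ht_cyc s i.+1) (ht_cyc s i) (up_nest s i) (up_cros s i) => a b c d.
    by move: (nat_of_bool (s i < i)%N) => f; lia.
  by rewrite /up_nest /up_cros !big1 ?mulr1 // => l _; lia.
have -> : (if (s i < i)%N
             then p ^+ low_nest s i * q ^+ ((ht_cyc s i).-1 - low_nest s i)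
             else 1)
   = p ^+ low_nest s i * q ^+ low_cros s i.
  case: ifPn => h.
    by rewrite -(low_nest_cros h) addn1 addKn.
  by rewrite /low_nest /low_cros !big1 ?mulr1 // => l _; lia.
by rewrite !exprD; ring.
Qed.

Lemma sum_nest_cros (R : comNzRingType) (p q y z : R) :
  \sum_(s : 'S_n | cdfall s == 0%N)
    p ^+ nest s * q ^+ (cros s + drop_stat s) * y ^+ drop_stat s
      * z ^+ (n - 2 * drop_stat s) = motz_pq p q y z n.
Proof.
rewrite -sum_wt_cyc -(sum_hists_inj _ labs_cyc_uniq word_cyc_mem word_cyc_inj).
  by rewrite big_mkcond; apply: eq_bigr => s _; rewrite word_cyc_wt.
by rewrite size_hists_cyc muln1 card_Sn.
Qed.

End CyclicHistories.

(** * Linear statistics *)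

Section LinearHistories.
Local Open Scope nat_scope.
Variable n : nat.
Implicit Types (s t : 'S_n) (i j u v w : 'I_n).

Lemma letter_ord s i : letter s i = s i.
Proof. by rewrite /letter valK. Qed.

Lemma letter_eq s (k : nat) v : (letter s k == v) = (k == (s^-1)%g v).
Proof.
rewrite /letter; case: insubP => [i _ <-|].
  by rewrite -[_ == _ :> nat]/(s i == v) perm_eqV.
by have := ltn_ord v; have := ltn_ord ((s^-1)%g v); lia.
Qed.

(* [blk s k i]: position [i] starts a non-initial maximal block of letters    *)
(* smaller than [k].                                                          *)
Definition blk s (k i : nat) : bool :=
  [&& 0 < i, letter s i < k & k <= letter s i.-1].

Definition ht_lin s (k : nat) : nat := \sum_(i < n) blk s k i.

(** A letter in position 0 counts as preceded by a smaller one, as if a letter minus infinity stood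
    in front. This matches the exclusion of the initial block in [blk]. *)
Definition asc_in s v : bool :=
  ((s^-1)%g v == 0 :> nat) || (letter s ((s^-1)%g v).-1 < v).
Definition desc_out s v : bool := letter s ((s^-1)%g v).+1 < v.
Definition blk_left s v : nat := \sum_(i < n) (blk s v i && (i < (s^-1)%g v)).
Definition blk_right s v : nat := \sum_(i < n) (blk s v i && (((s^-1)%g v).+1 < i)).

Definition lab_lin s v : step := ((asc_in s v, desc_out s v), (blk_left s v, 0)).

Lemma letterK s v : letter s ((s^-1)%g v) = v.
Proof. by rewrite letter_ord permKV. Qed.

Lemma desc_out_lt s v : desc_out s v -> ((s^-1)%g v).+1 < n.
Proof.
rewrite /desc_out /letter; case: insubP => [i lti _ //|_].
by rewrite ltnNge (ltnW (ltn_ord v)).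
Qed.

Lemma blk_desc_out s v : desc_out s v -> blk s v ((s^-1)%g v).+1.
Proof. by rewrite /blk /= letterK leqnn andbT. Qed.

Lemma desc_out_sum s v :
  \sum_(i < n) ((i == ((s^-1)%g v).+1 :> nat) && blk s v i) = desc_out s v.
Proof.
have [d|/negPf d] := boolP (desc_out s v); last first.
  rewrite big1 // => i _; case: eqP => // ->.
  by rewrite /blk -/(desc_out s v) d.
by rewrite (sum_eqb (Ordinal (desc_out_lt d)) (fun i => blk s v i)) /= blk_desc_out.
Qed.

Lemma asc_inN s v :
  ~~ asc_in s v = (0 < (s^-1)%g v) && (v < letter s ((s^-1)%g v).-1).
Proof.
rewrite /asc_in; have := letter_eq s ((s^-1)%g v).-1 v.
move: (letter s ((s^-1)%g v).-1) (nat_of_ord ((s^-1)%g v)) => a [|k] //=; lia.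
Qed.

Lemma blk_left_right s v :
  blk_left s v + desc_out s v + blk_right s v = ht_lin s v.
Proof.
rewrite -desc_out_sum -!big_split; apply: eq_bigr => i _ /=.
have [b|] := boolP (blk s v i); last by rewrite !andbF.
have : (i != (s^-1)%g v :> nat).
  by rewrite -letter_eq; move: b; rewrite /blk; lia.
rewrite andbT; lia.
Qed.

(** Making [v] a small letter creates a block start at [v] unless [asc_in] holds, and absorbs the
    block start just after [v] if [desc_out] holds. *)
Lemma ht_linS s v :
  ht_lin s v.+1 + (asc_in s v + desc_out s v) = ht_lin s v + 1.
Proof.
suff : ht_lin s v.+1 + desc_out s v = ht_lin s v + ~~ asc_in s v.
  by case: (asc_in s v); rewrite /=; lia.
rewrite asc_inN -desc_out_sum.
rewrite -(sum_eqb ((s^-1)%g v) (fun i => (0 < i) && (v < letter s i.-1))).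
rewrite -!big_split; apply: eq_bigr => i _ /=; rewrite -[i == _]val_eqE /blk /=.
have := letter_eq s i v; have := letter_eq s i.-1 v.
move: (letter s i) (letter s i.-1) (nat_of_ord i).
move: (nat_of_ord ((s^-1)%g v)) (nat_of_ord v) => d e a b [|c] /=; lia.
Qed.

Lemma after_lab_lin s v : after (ht_lin s v) (lab_lin s v) = ht_lin s v.+1.
Proof. by rewrite /after -addn1 -ht_linS addnK. Qed.

Lemma lab_lin_mem s v : lab_lin s v \in labs_lin (ht_lin s v).
Proof. by rewrite mem_labs_lin eqxx andbT -blk_left_right leq_addr. Qed.

Definition word_lin s : seq step := [seq lab_lin s v | v <- enum 'I_n].

Lemma word_lin_mem s : word_lin s \in hists labs_lin n 0.
Proof.
have -> : 0 = ht_lin s 0 by rewrite /ht_lin big1 // => i _; rewrite /blk andbF.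
apply: hists_mem; [exact: lab_lin_mem | exact: after_lab_lin |].
rewrite /ht_lin big1 // => i _; rewrite /blk.
case: i => -[|i] lti //=; have lti' := ltnW lti.
have := ltn_ord (s (Ordinal lti')); rewrite -letter_ord /= ltnNge => /negPf->.
by rewrite andbF.
Qed.

(* The letter [v] lies between two blocks of smaller letters, so a smaller    *)
(* letter is to its right exactly when its block is.                          *)
Lemma lt_posE s u v : u < v ->
  ((s^-1)%g v < (s^-1)%g u) =
  (blk_left s v < \sum_(i < n) (blk s v i && (i <= (s^-1)%g u))).
Proof.
move=> ltuv; have luv : letter s ((s^-1)%g u) < v by rewrite letterK.
apply/idP/idP => [ltP|]; last first.
  apply: contraTT; rewrite -!leqNgt => leP; apply: leq_sum => i _.
  by have := letter_eq s i v; rewrite /blk; lia.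
have exi : exists i : nat, ((s^-1)%g v < i) && (letter s i < v).
  by exists (nat_of_ord ((s^-1)%g u)); rewrite ltP.
(* The first smaller letter to the right of [v] starts a block, which is counted up to [u] but not
   in [blk_left]. *)
case: (ex_minnP exi) => i0 /andP[lt0 l0] min0.
have le0 : i0 <= (s^-1)%g u by apply: min0; rewrite ltP.
have lt0n : i0 < n by rewrite (leq_ltn_trans le0).
have b0 : blk s v (Ordinal lt0n).
  rewrite /blk /= l0 /=; case: i0 lt0 {l0 le0 lt0n} min0 => //= i0.
  rewrite ltnS leq_eqVlt.
  case/orP=> [/eqP <- _|lt0 /(_ i0)]; first by rewrite letterK.
  by rewrite lt0 ltnn /= => h; rewrite leqNgt; apply/negP => /h.
rewrite -addn1 /blk_left.
have <- : \sum_(i < n) ((i == Ordinal lt0n) && blk s v i) = 1 by rewrite sum_eqb b0.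
rewrite -big_split; apply: leq_sum => i _ /=.
rewrite -val_eqE /=; case: (blk s v i) => //=; lia.
Qed.

(** Only the block starting just after [v] loses its start. It is recognised by its rank among the
    blocks, which is [blk_left s v]; this uses shape data only, not positions. *)
Lemma blk_posS s v w : w < v ->
  blk s v.+1 ((s^-1)%g w) =
  blk s v ((s^-1)%g w) &&
  ~~ (desc_out s v &&
      (\sum_(i < n) (blk s v i && (i < (s^-1)%g w)) == blk_left s v)).
Proof.
move=> ltwv; have e : blk s v.+1 ((s^-1)%g w) =
    blk s v ((s^-1)%g w) && ((s^-1)%g w != ((s^-1)%g v).+1 :> nat).
  have := letter_eq s ((s^-1)%g w).-1 v; rewrite /blk letterK.
  move: (letter s ((s^-1)%g w).-1) (nat_of_ord ((s^-1)%g w)) => a [|k] //=.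
  rewrite eqSS; lia.
rewrite e; have [b|//] := boolP (blk s v ((s^-1)%g w)); congr (~~ _).
have rank_next : \sum_(i < n) (blk s v i && (i < ((s^-1)%g v).+1)) = blk_left s v.
  apply: eq_bigr => i _; have := letter_eq s i v; rewrite /blk; lia.
apply/eqP/andP => [ew|[d /eqP rw]].
  by rewrite /desc_out -ew letterK ew rank_next.
pose i0 := Ordinal (desc_out_lt d); rewrite -[RHS]/(nat_of_ord i0).
congr nat_of_ord; apply: (rank_inj (O := [pred i : 'I_n | blk s v i])) => //=.
  exact: blk_desc_out.
by rewrite rw rank_next.
Qed.

Definition same_shape s t k :=
  (forall u w, u < k -> w < k ->
     ((s^-1)%g u < (s^-1)%g w) = ((t^-1)%g u < (t^-1)%g w)) /\
  (forall w, w < k -> blk s k ((s^-1)%g w) = blk t k ((t^-1)%g w)).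

Lemma same_shapeS s t v : lab_lin s v = lab_lin t v ->
  same_shape s t v -> same_shape s t v.+1.
Proof.
move=> [ea ed el] [lt_st blk_st].
(* Block counts are re-indexed by the letter at the block start; only letters below [v] contribute,
   and there the shapes agree. *)
have sum_st u (P : rel nat) : u < v ->
    (forall w, w < v -> P ((s^-1)%g w) ((s^-1)%g u) = P ((t^-1)%g w) ((t^-1)%g u)) ->
    \sum_(i < n) (blk s v i && P i ((s^-1)%g u)) =
    \sum_(i < n) (blk t v i && P i ((t^-1)%g u)).
  move=> ltuv eP; rewrite -(sum_perm (s^-1)%g (fun i => blk s v i && P i _ : nat)).
  rewrite -(sum_perm (t^-1)%g (fun i => blk t v i && P i _ : nat)).
  apply: eq_bigr => w _; have [ltwv|levw] := ltnP w v; first by rewrite blk_st ?eP.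
  by rewrite /blk !letterK (ltnNge w) levw !andbF.
have lt_v u : u < v -> ((s^-1)%g v < (s^-1)%g u) = ((t^-1)%g v < (t^-1)%g u).
  move=> ltuv; rewrite !lt_posE // el; congr (_ < _).
  by apply: (sum_st u leq) => // w ltwv; rewrite [LHS]leqNgt [RHS]leqNgt lt_st.
have neq_pos (r : 'S_n) u w : u < w -> ((r^-1)%g u != (r^-1)%g w :> nat).
  by move=> lt; rewrite val_eqE (inj_eq perm_inj) -val_eqE neq_ltn lt.
split=> [u w|w]; rewrite !ltnS.
  rewrite [u <= v]leq_eqVlt [w <= v]leq_eqVlt.
  move=> /orP[/eqP/val_inj->|ltuv] /orP[/eqP/val_inj->|ltwv].
  - by rewrite !ltnn.
  - exact: lt_v.
  - have := lt_v _ ltuv; have := neq_pos s _ _ ltuv; have := neq_pos t _ _ ltuv.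
    lia.
  - exact: lt_st.
rewrite leq_eqVlt => /orP[/eqP/val_inj->|ltwv].
  by rewrite /blk !letterK ltnS leqnn -!asc_inN ea.
rewrite !blk_posS // ed el blk_st //; congr (_ && ~~ (_ && (_ == _))).
by apply: (sum_st w ltn) => // u ltuv; rewrite /= lt_st.
Qed.

Lemma sum_ltn_ord k : k <= n -> \sum_(i < n) (i < k) = k.
Proof.
move=> lekn; rewrite -[RHS]card_ord -sum1_card (big_ord_widen _ (fun=> 1) lekn).
by rewrite [RHS]big_mkcond; apply: eq_bigr => i _; case: (i < k).
Qed.

Lemma word_lin_inj : injective word_lin.
Proof.
move=> s t /eq_in_map e.
have {}e k : lab_lin s k = lab_lin t k by apply: e; rewrite mem_enum.
have A k : k <= n -> same_shape s t k.
  elim: k => [|k IH] ltkn; first by split.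
  by apply: (@same_shapeS s t (Ordinal ltkn)); last exact: IH (ltnW ltkn).
have [lt_st _] := A n (leqnn n).
apply: invg_inj; apply/permP => u; apply/val_inj => /=.
(* A position is the number of letters to its left, hence is recovered from the relative order. *)
have rkE s' : (s'^-1)%g u = \sum_(w < n) ((s'^-1)%g w < (s'^-1)%g u) :> nat.
  rewrite (sum_perm (s'^-1)%g (fun i : 'I_n => (i < (s'^-1)%g u) : nat)).
  by rewrite sum_ltn_ord // ltnW.
by rewrite (rkE s) (rkE t); apply: eq_bigr => w _; rewrite lt_st.
Qed.

Lemma pat31_2_sum s : pat31_2 s = \sum_(v < n) blk_left s v.
Proof.
rewrite /pat31_2 card_pairs_sum exchange_big.
rewrite -(sum_perm (s^-1)%g) /=; apply: eq_bigr => v _.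
apply: eq_bigr => i _; rewrite permKV /blk letter_ord.
have := letter_eq s i.-1 v.
by case: (nat_of_ord i) => [|k] //=; lia.
Qed.

Lemma sum_succ_shift m (G : nat -> nat -> nat) :
  \sum_(i < m) (i.+1 < m) * G i i.+1 = \sum_(i < m) (0 < i) * G i.-1 i.
Proof.
case: m => [|m]; first by rewrite !big_ord0.
rewrite big_ord_recr big_ord_recl /= ltnn !mul0n addn0 add0n.
by apply: eq_bigr => i _; rewrite /= ltnS (ltn_ord i).
Qed.

Lemma pat2_31_sum s : pat2_31 s = \sum_(v < n) blk_right s v.
Proof.
rewrite /pat2_31 card_pairs_sum -(sum_perm (s^-1)%g); apply: eq_bigr => v _.
rewrite permKV /blk_right.
pose G (i j : nat) : nat := [&& (s^-1)%g v < i, letter s j < v & v < letter s i].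
transitivity (\sum_(i < n) (i.+1 < n) * G i i.+1).
  apply: eq_bigr => j _; rewrite /G letter_ord.
  by case: (_ < n); rewrite ?andbF ?mul0n ?mul1n.
transitivity (\sum_(i < n) (0 < i) * G i.-1 i).
  exact: sum_succ_shift.
apply: eq_bigr => i _; have := letter_eq s i.-1 v; rewrite /G /blk.
case: (nat_of_ord i) => [|k] //=; lia.
Qed.

Lemma des_sum s : des s = \sum_(v < n) desc_out s v.
Proof.
rewrite /des card_set_sum -(sum_perm (s^-1)%g); apply: eq_bigr => v _.
congr (nat_of_bool _); rewrite permKV -/(desc_out s v).
by case: (boolP (desc_out s v)) => [/desc_out_lt -> //|_]; rewrite andbF.
Qed.

Lemma dd_sum s : dd s = \sum_(v < n) (~~ asc_in s v && desc_out s v).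
Proof.
rewrite /dd card_set_sum -(sum_perm (s^-1)%g); apply: eq_bigr => v _.
by congr (nat_of_bool _); rewrite permKV asc_inN andbA.
Qed.

Lemma asc_des s : \sum_(v < n) asc_in s v + \sum_(v < n) desc_out s v = n.
Proof.
have labsP h l : l \in labs_lin h -> l.1.1 + l.1.2 <= h.+1.
  by case: l => -[a b] [r x]; rewrite mem_labs_lin /=; case: a b => [] []; lia.
have := hists_balance labsP (word_lin_mem s).
by rewrite !big_map addn0.
Qed.

Local Open Scope ring_scope.

Lemma word_lin_wt (R : comNzRingType) (p q y z : R) s :
  hist_wt (wt_lin p q y z) 0 (word_lin s) =
  if dd s == 0%N
  then p ^+ pat2_31 s * q ^+ (pat31_2 s + des s) * y ^+ des s
       * z ^+ (n - 2 * des s)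
  else 0.
Proof.
have {1}-> : 0%N = ht_lin s 0 by rewrite /ht_lin big1 // => i _; rewrite /blk andbF.
rewrite (hist_wt_prod _ (@after_lab_lin s)).
rewrite (eq_bigr (fun i => step_wt q y z (lab_lin s i) *
   (p ^+ blk_right s i * q ^+ blk_left s i))).
  rewrite big_split /= prod_step_wt ?asc_des //= -dd_sum -des_sum.
  case: ifP => _; last by rewrite mul0r.
  rewrite big_split /= !prodrXr -pat2_31_sum -pat31_2_sum exprD exprMn; ring.
move=> i _; rewrite /wt_lin /= -(blk_left_right s i); congr (_ * (_ ^+ _ * _)).
by rewrite addnAC addnK addKn.
Qed.

Lemma sum_pat31 (R : comNzRingType) (p q y z : R) :
  \sum_(s : 'S_n | dd s == 0%N)
    p ^+ pat2_31 s * q ^+ (pat31_2 s + des s) * y ^+ des s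
      * z ^+ (n - 2 * des s) = motz_pq p q y z n.
Proof.
rewrite -sum_wt_lin -(sum_hists_inj _ labs_lin_uniq word_lin_mem word_lin_inj).
  by rewrite big_mkcond; apply: eq_bigr => s _; rewrite word_lin_wt.
by rewrite size_hists_lin card_Sn.
Qed.

End LinearHistories.

(** * Extraction of the two identities from the common path sum *)

Section Equidistribution.
Variable R : comNzRingType.

Lemma coef_sum_mark (T : finType) (P : pred T) (d : T -> nat) (f : T -> R) k :
  (\sum_(s | P s) (f s)%:P * 'X^(d s))`_k = \sum_(s | P s && (d s == k)) f s.
Proof.
rewrite coef_sum [RHS]big_mkcondr; apply: eq_bigr => s _.
by rewrite coefCM coefXn eq_sym; case: eqP; rewrite ?mulr1 ?mulr0.
Qed.

Lemma gamma_hat_tilde (p q : R) n k :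
  gamma_hat p q n k =
  \sum_(s in Gamma_tilde n k) p ^+ pat2_31 s * q ^+ (pat31_2 s + k).
Proof.
have e : \sum_(s : 'S_n | cdfall s == 0%N)
      (p ^+ nest s * q ^+ (cros s + drop_stat s))%:P * 'X^(drop_stat s) =
    \sum_(s : 'S_n | dd s == 0%N)
      (p ^+ pat2_31 s * q ^+ (pat31_2 s + des s))%:P * 'X^(des s).
  (* Working over [{poly R}] with [y = 'X] and [z = 1] keeps the statistic as an exponent, so that
     coefficient [k] isolates its level set. *)
  have := sum_nest_cros n p%:P q%:P 'X 1; rewrite -(sum_pat31 n p%:P q%:P 'X 1).
  under eq_bigr do rewrite expr1n mulr1 -!rmorphXn -rmorphM.
  by under [RHS]eq_bigr do rewrite expr1n mulr1 -!rmorphXn -rmorphM.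
have := congr1 (fun r : {poly R} => r`_k) e; rewrite !coef_sum_mark.
rewrite /gamma_hat => ek.
transitivity (\sum_(s : 'S_n | (cdfall s == 0%N) && (drop_stat s == k))
   p ^+ nest s * q ^+ (cros s + drop_stat s)).
  by apply: eq_big => s; rewrite inE // => /andP[_ /eqP ->].
by rewrite ek; apply: eq_big => [s|s /andP[_ /eqP ->]]; rewrite ?inE.
Qed.

Lemma Ahat_gamma_hat (t p q : R) n :
  Ahat t p q n =
  \sum_(0 <= k < (n %/ 2).+1) gamma_hat p q n k * t ^+ k * (1 + t) ^+ (n - 2 * k).
Proof.
rewrite /Ahat jfraction_motz; last by rewrite /pqint big_ord0 expr0n mulr0.
rewrite -[LHS]/(motz_pq p q t (1 + t) n) -sum_nest_cros big_mkord.
(* On permutations with [cdfall s = 0], [drop_le] ensures that [inord] does not fall back to its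
   default value. *)
pose dr (s : 'S_n) : 'I_(n %/ 2).+1 := inord (drop_stat s).
rewrite (partition_big dr xpredT) //; apply: eq_bigr => k _.
rewrite /gamma_hat !mulr_suml; apply: eq_big => [s|s /andP[/eqP c0 /eqP <-]].
  rewrite inE; have [c0|//] := eqVneq (cdfall s) 0%N.
  by rewrite -val_eqE /= inordK // ltnS leq_divRL // mulnC drop_le.
by rewrite /dr inordK // ltnS leq_divRL // mulnC drop_le.
Qed.

End Equidistribution.

Theorem theorem4p8 (n : nat) (hn : (1 <= n)%N) :
  Ahat tX pX qX n =
    \sum_(0 <= k < (n %/ 2).+1)
      gamma_hat pX qX n k * tX ^+ k * (1 + tX) ^+ (n - 2 * k)
  /\ (forall k : nat, (k <= n %/ 2)%N ->
       gamma_hat pX qX n k =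
         \sum_(s in Gamma_tilde n k)
           pX ^+ pat2_31 s * qX ^+ (pat31_2 s + k)).
Proof. by split=> [|k _]; [exact: Ahat_gamma_hat | exact: gamma_hat_tilde]. Qed.
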